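(* There exists a language $L_{\mathrm{univ}}\subseteq\{0,1\}^*$ such that $X_{L_{\mathrm{univ}}}$ contains a closed subspace linearly isometric to $C(\Delta)$, where $\Delta=\{0,1\}^{\mathbb N}$ is the Cantor space.
   Context: All Banach spaces are real. $\{0,1\}^*$ is the free monoid of finite binary words. For $L\subseteq\{0,1\}^*$ and a word $w$, $w^{-1}L=\{v\in\{0,1\}^*:wv\in L\}$, $\mathbf 1_B$ is the characteristic function of $B$, and $X_L=\overline{\operatorname{span}}\{\mathbf 1_{w^{-1}L}:w\in\{0,1\}^*\}\subset\ell_\infty(\{0,1\}^* )$, where $\ell_\infty(\{0,1\}^* )$ is the space of bounded real functions on $\{0,1\}^*$ with the supremum norm and the closure is in that norm. $\Delta$ carries the product topology and $C(\Delta)$ is the Banach space of continuous real functions on $\Delta$ with the supremum norm. *)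

(* Defs.v *)
From HB Require Import structures.
From mathcomp Require Import all_boot all_order all_algebra.
From mathcomp Require Import all_classical all_reals all_analysis.

Set Implicit Arguments.
Unset Strict Implicit.
Unset Printing Implicit Defensive.

Import Order.TTheory GRing.Theory Num.Theory.
Import numFieldNormedType.Exports.

Local Open Scope classical_set_scope.
Local Open Scope ring_scope.

Section sup_norm.
Context {T : Type} {R : realType}.
Implicit Types f g : T -> R.

(* Since [sup set0 = 0], this is also correct when [T] is empty. *)
Definition sup_norm f : R := sup [set `|f x| | x in [set: T]].

Lemma bounded_funP f :
  bounded_fun f <-> exists M, forall x, `|f x| <= M.
Proof.
split=> [[M [_ fM]]|[M fM]].
  by exists (M + 1) => x; apply: (fM (M + 1)); rewrite ?ltrDl.
by exists M; split=> [|N MN x _]; [rewrite num_real|apply: le_trans (fM x) (ltW MN)].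
Qed.

Lemma le_sup_norm f x : bounded_fun f -> `|f x| <= sup_norm f.
Proof.
move=> /bounded_funP[M fM]; apply: sup_upper_bound; last by exists x.
by split; [exists `|f x|, x | exists M => _ [y _ <-]; exact: fM].
Qed.

Lemma sup_norm_le f M : 0 <= M -> (forall x, `|f x| <= M) -> sup_norm f <= M.
Proof.
move=> M0 fM; rewrite /sup_norm.
have [->|/set0P S0] := eqVneq [set `|f x| | x in [set: T]] set0.
  by rewrite sup0.
by apply: ge_sup => // _ [x _ <-]; exact: fM.
Qed.

Lemma sup_norm_ge0 f : bounded_fun f -> 0 <= sup_norm f.
Proof.
move=> bf; rewrite /sup_norm.
have [->|/set0P[_ [x _ _]]] := eqVneq [set `|f x| | x in [set: T]] set0.
  by rewrite sup0.
by rewrite (le_trans _ (le_sup_norm x bf)).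
Qed.

Lemma ler_sup_normD f g : bounded_fun f -> bounded_fun g ->
  sup_norm (f + g) <= sup_norm f + sup_norm g.
Proof.
move=> bf bg; apply: sup_norm_le => [|x]; first by rewrite addr_ge0 ?sup_norm_ge0.
by rewrite (le_trans (ler_normD _ _))// lerD ?le_sup_norm.
Qed.

Lemma bounded_funZ (a : R) f : bounded_fun f -> bounded_fun (a *: f).
Proof.
move=> /bounded_funP[M fM]; apply/bounded_funP; exists (`|a| * M) => x.
by rewrite normrM ler_wpM2l.
Qed.

Lemma sup_norm_leZ (a : R) f : bounded_fun f ->
  sup_norm (a *: f) <= `|a| * sup_norm f.
Proof.
move=> bf; apply: sup_norm_le => [|x]; first by rewrite mulr_ge0 ?sup_norm_ge0.
by rewrite normrM ler_wpM2l ?le_sup_norm.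
Qed.

Lemma sup_normZ (a : R) f : bounded_fun f ->
  sup_norm (a *: f) = `|a| * sup_norm f.
Proof.
move=> bf; apply/eqP; rewrite eq_le sup_norm_leZ//=.
have [->|a0] := eqVneq a 0.
  by rewrite normr0 mul0r sup_norm_ge0//; exact: bounded_funZ.
rewrite -ler_pdivlMl ?normr_gt0// -normfV.
rewrite -{1}[f](scalerK a0) sup_norm_leZ//.
exact: bounded_funZ.
Qed.

Lemma sup_norm_eq0 f : bounded_fun f -> sup_norm f = 0 -> f = 0.
Proof.
move=> bf f0; apply/funext => x; apply/eqP.
by rewrite -normr_le0 -f0 le_sup_norm.
Qed.

End sup_norm.

Record linfty (T : Type) (R : realType) := Linfty {
  linfty_fun :> T -> R ;
  linftyP : bounded_fun linfty_fun }.
Arguments Linfty {T R}.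

Section linfty_normedModType.
Context {T : Type} {R : realType}.

Definition bounded_pred : {pred T -> R} := [pred f : T -> R | `[< bounded_fun f >]].

Let linfty_Sub (f : T -> R) (bf : f \in bounded_pred) : linfty T R :=
  Linfty f (asboolW bf).

Let linfty_rect (K : linfty T R -> Type) :
  (forall f (bf : f \in bounded_pred), K (linfty_Sub bf)) -> forall u, K u.
Proof.
move=> KS [f bf]; have bf' : f \in bounded_pred by apply/asboolP.
by rewrite (Prop_irrelevance bf (asboolW bf')); exact: KS.
Qed.

Let linfty_SubK (f : T -> R) (bf : f \in bounded_pred) :
  linfty_fun (linfty_Sub bf) = f.
Proof. by []. Qed.

HB.instance Definition _ :=
  isSub.Build (T -> R) bounded_pred (linfty T R) linfty_rect linfty_SubK.
HB.instance Definition _ := [Choice of linfty T R by <:].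

Lemma bounded_submod_closed : submod_closed bounded_pred.
Proof.
split=> [|a f g /asboolP bf /asboolP bg]; apply/asboolP.
  by apply/bounded_funP; exists 0 => x; rewrite normr0.
by apply: bounded_funD bg; exact: bounded_funZ.
Qed.

HB.instance Definition _ :=
  GRing.isSubmodClosed.Build R (T -> R) bounded_pred bounded_submod_closed.
HB.instance Definition _ := [SubChoice_isSubLmodule of linfty T R by <:].

Let linfty_norm (f : linfty T R) : R := sup_norm f.

Let ler_linfty_normD f g : linfty_norm (f + g) <= linfty_norm f + linfty_norm g.
Proof. by apply: ler_sup_normD; exact: linftyP. Qed.

Let linfty_normZ (a : R) f : linfty_norm (a *: f) = `|a| * linfty_norm f.
Proof. by apply: sup_normZ; exact: linftyP. Qed.

Let linfty_norm_eq0 f : linfty_norm f = 0 -> f = 0.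
Proof. by move=> f0; apply/val_inj/sup_norm_eq0 => //; exact: linftyP. Qed.

HB.instance Definition _ := Lmodule_isNormed.Build R (linfty T R)
  ler_linfty_normD linfty_normZ linfty_norm_eq0.

Lemma linfty_normE (f : linfty T R) : `|f| = sup_norm f.
Proof. by []. Qed.

End linfty_normedModType.

Record continuous_cantor (R : realType) := ContinuousCantor {
  continuous_cantor_fun :> cantor_space -> R ;
  continuous_cantorP : continuous continuous_cantor_fun }.
Arguments ContinuousCantor {R}.

Section continuous_cantor_normedModType.
Context {R : realType}.

Definition continuous_pred : {pred cantor_space -> R} :=
  [pred f : cantor_space -> R | `[< continuous f >]].

Let C_Sub (f : cantor_space -> R) (cf : f \in continuous_pred) :
  continuous_cantor R := ContinuousCantor f (asboolW cf).

Let C_rect (K : continuous_cantor R -> Type) :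
  (forall f (cf : f \in continuous_pred), K (C_Sub cf)) -> forall u, K u.
Proof.
move=> KS [f cf]; have cf' : f \in continuous_pred by apply/asboolP.
by rewrite (Prop_irrelevance cf (asboolW cf')); exact: KS.
Qed.

Let C_SubK (f : cantor_space -> R) (cf : f \in continuous_pred) :
  continuous_cantor_fun (C_Sub cf) = f.
Proof. by []. Qed.

HB.instance Definition _ := isSub.Build (cantor_space -> R) continuous_pred
  (continuous_cantor R) C_rect C_SubK.
HB.instance Definition _ := [Choice of continuous_cantor R by <:].

Lemma continuous_submod_closed : submod_closed continuous_pred.
Proof.
split=> [|a f g /asboolP cf /asboolP cg]; apply/asboolP => x.
  exact: cvg_cst.
by apply: cvgD; [apply: cvgZr; exact: cf|exact: cg].
Qed.

HB.instance Definition _ := GRing.isSubmodClosed.Build R (cantor_space -> R)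
  continuous_pred continuous_submod_closed.
HB.instance Definition _ := [SubChoice_isSubLmodule of continuous_cantor R by <:].

Lemma continuous_cantor_bounded (f : continuous_cantor R) : bounded_fun f.
Proof.
have /compact_bounded[M [Mreal fM]] : compact (f @` [set: cantor_space]).
  apply: continuous_compact; last exact: cantor_space_compact.
  exact/continuous_subspaceT/continuous_cantorP.
by exists M; split=> // N MN x _; apply: (fM N MN); exists x.
Qed.

Let C_norm (f : continuous_cantor R) : R := sup_norm f.

Let ler_C_normD f g : C_norm (f + g) <= C_norm f + C_norm g.
Proof. by apply: ler_sup_normD; exact: continuous_cantor_bounded. Qed.

Let C_normZ (a : R) f : C_norm (a *: f) = `|a| * C_norm f.
Proof. by apply: sup_normZ; exact: continuous_cantor_bounded. Qed.

Let C_norm_eq0 f : C_norm f = 0 -> f = 0.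
Proof.
by move=> f0; apply/val_inj/sup_norm_eq0 => //; exact: continuous_cantor_bounded.
Qed.

HB.instance Definition _ := Lmodule_isNormed.Build R (continuous_cantor R)
  ler_C_normD C_normZ C_norm_eq0.

Lemma continuous_cantor_normE (f : continuous_cantor R) : `|f| = sup_norm f.
Proof. by []. Qed.

End continuous_cantor_normedModType.

Definition linear_span {R : pzRingType} {V : lmodType R} (A : set V) : set V :=
  [set x | exists n (a : 'I_n -> R) (v : 'I_n -> V),
    (forall i, A (v i)) /\ x = \sum_(i < n) a i *: v i].

Definition word := seq bool.
Definition language := set word.

Definition left_quotient (w : word) (L : language) : language :=
  [set v | L (w ++ v)].

Lemma indic_bounded (T : Type) (R : realType) (A : set T) :
  bounded_fun (\1_A : T -> R).
Proof.
apply/bounded_funP; exists 1 => x.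
by rewrite indicE; case: (x \in A); rewrite ?normr1 ?normr0.
Qed.

Definition linfty_indic {T : Type} (R : realType) (A : set T) : linfty T R :=
  Linfty \1_A (@indic_bounded T R A).

Definition residual_space (R : realType) (L : language) : set (linfty word R) :=
  closure (linear_span
    [set linfty_indic R (left_quotient w L) | w in [set: word]]).
Arguments residual_space R L : clear implicits.

(* [J] is automatically injective, hence a bijection of [V] onto [Y]. *)
Definition linearly_isometric_to {R : numFieldType} {V W : normedModType R}
    (Y : set W) : Prop :=
  exists2 J : {linear V -> W}, (forall x, `|J x| = `|x|) & range J = Y.
Arguments linearly_isometric_to {R} V {W} Y.

(* Main.v *)
Require Import Defs.
From HB Require Import structures.
From mathcomp Require Import all_boot all_order all_algebra.
From mathcomp Require Import all_classical all_reals all_analysis.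
From mathcomp Require Import lra.

Import Order.TTheory GRing.Theory Num.Theory.
Import numFieldNormedType.Exports.

Local Open Scope classical_set_scope.
Local Open Scope ring_scope.

(** The words, read as the binary sequences [pad w = w000...], form a dense
    subset of the Cantor space.  Hence [f |-> f \o pad] embeds the continuous
    functions isometrically into the bounded functions on words, whatever the
    language is.  The language only has to bring the image of this embedding
    into its residual space.

    A continuous function on the Cantor space is a uniform limit of
    combinations of indicators of cylinders ([cantor_continuousP]), so it is
    enough that, for each word [u], the set of words [v] with [pad v] in the
    cylinder of [u] be a residual.  There are countably many such sets, and a
    prefix-free code packs them into one language: the words [code u ++ v] with
    [pad v] in the cylinder of [u].  Reading [code u] then leaves exactly the
    set attached to [u] ([left_quotient_code]), and the step functions that
    approximate [f] become finite combinations of indicators of residuals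
    ([range_restrict_pad_residual]).

    The image is closed because a uniform limit [g] of functions [f_k \o pad]
    extends to the continuous function [x |-> lim_n g (x_0 ... x_(n-1))]
    ([closed_range_restrict_pad]). *)

Lemma closureP_norm {R : realType} {V : normedModType R} {A : set V} {g : V} :
  closure A g <-> forall e, 0 < e -> exists2 h, A h & `|g - h| < e.
Proof.
split=> [Ag e e0|Ag B].
  have [h [Ah gh]] := Ag _ (nbhsx_ballx g e e0).
  by exists h => //; move: gh; rewrite -ball_normE.
move=> /nbhs_ballP[e /= e0 eB]; have [h Ah gh] := Ag e e0.
by exists h; split=> //; apply: eB; rewrite -ball_normE.
Qed.

Lemma linfty_norm_le {T : Type} {R : realType} (g : linfty T R) e : 0 <= e ->
  (forall w, `|g w| <= e) -> `|g| <= e.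
Proof. by move=> e0 ge; rewrite linfty_normE; exact: sup_norm_le. Qed.

Lemma ler_linfty_norm {T : Type} {R : realType} (g : linfty T R) w :
  `|g w| <= `|g|.
Proof. by rewrite linfty_normE; apply: le_sup_norm; exact: linftyP. Qed.

Lemma linear_span_sum {K : pzRingType} {V : lmodType K} (A : set V)
    (I : finType) (a : I -> K) (v : I -> V) :
  (forall i, A (v i)) -> linear_span A (\sum_i a i *: v i).
Proof.
move=> Av; exists #|I|, (a \o enum_val), (v \o enum_val); split=> [i|] //=.
by rewrite (reindex _ (onW_bij _ (enum_val_bij I))).
Qed.

Definition agree (n : nat) (x y : nat -> bool) :=
  forall i, (i < n)%N -> x i = y i.

Lemma agree_sym {n x y} : agree n x y -> agree n y x.
Proof. by move=> xy i /xy. Qed.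

Lemma agree_trans {n x y z} : agree n x y -> agree n y z -> agree n x z.
Proof. by move=> xy yz i ni; rewrite xy// yz. Qed.

Lemma agree_leq {m n x y} : (m <= n)%N -> agree n x y -> agree m x y.
Proof. by move=> mn xy i im; apply: xy; exact: leq_trans im mn. Qed.

(** The word continued by zeros.  Points of this form meet every cylinder,
    which is what makes [pad] an embedding of words with dense range. *)
Definition pad (w : word) : cantor_space := nth false w.

Lemma agree_pad_mkseq n x : agree n x (pad (mkseq x n)).
Proof. by move=> i ni; rewrite /pad nth_mkseq. Qed.

Lemma nbhs_agree n (x : cantor_space) : nbhs x (agree n x).
Proof.
elim: n => [|n IHn]; first by apply: filterS filterT => y _ i.
have nx := @proj_continuous _ (fun=> bool) n x _ (discrete_set1 (x n)).
apply: filterS2 IHn nx => y xy xyn i; rewrite ltnS leq_eqVlt.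
by move=> /predU1P[->|/xy//].
Qed.

(** Cylinders form a base: the filter they generate converges to [x] because it
    does so in each coordinate, and the product topology is the coarsest for
    which that suffices. *)
Lemma nbhs_agreeP {x : cantor_space} {B : set cantor_space} :
  nbhs x B -> exists n, agree n x `<=` B.
Proof.
pose F := filter_from [set: nat] (fun n => agree n x : set cantor_space).
have FF : Filter F.
  apply: filter_from_filter; first by exists 0%N.
  move=> m n _ _; exists (maxn m n) => // y xy; split.
    by apply: agree_leq xy; rewrite leq_maxl.
  by apply: agree_leq xy; rewrite leq_maxr.
have Fx : F --> x.
  apply/cvg_sup => i U [V] [[W oW <-] Wx WU].
  by apply: (filterS WU); exists i.+1 => // y xy /=; rewrite /= -xy.
by move=> /Fx[n _ nB]; exists n.
Qed.

(** Compactness turns continuity into uniform continuity, and on the Cantor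
    space the latter says that [f] is, up to [e], a function of the first [n]
    digits.  All later uses of continuity go through this form: density of the
    padded words, approximation by step functions, and closedness. *)
Lemma cantor_continuousP {R : realType} {f : cantor_space -> R} :
  continuous f <->
  forall e, 0 < e -> exists n, forall x y, agree n x y -> `|f x - f y| < e.
Proof.
split=> [cf e e0|fP x]; last first.
  apply/cvgrPdist_lt => e /fP[n nP].
  by apply: filterS (nbhs_agree n x) => y /nP.
have /compact_near_coveringP cpt := cantor_space_compact.
have [] := cpt nat \oo
  (fun n x => forall y, agree n x y -> `|f x - f y| < e) _ _; last first.
  by move=> n _ nP; exists n => x y; apply: (nP n) => /=.
move=> x _; have e20 : 0 < e / 2 by rewrite divr_gt0.
have /cvgrPdist_lt/(_ _ e20)/nbhs_agreeP[m mP] := cf x.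
exists (agree m x, [set n | (m <= n)%N]) => /=.
  by split; [exact: nbhs_agree|exists m].
move=> [x' n] /= [xx' mn] y x'y; rewrite (splitr e).
rewrite -(subrKA (f x)) (le_lt_trans (ler_normD _ _))// ltrD//.
  by rewrite distrC; exact: mP.
by apply/mP/(agree_trans xx'); exact: agree_leq x'y.
Qed.

(** Each letter is announced by [true] and the end of the word by [false], so a
    reader knows where the code stops. *)
Fixpoint code (u : word) : word :=
  if u is b :: u' then [:: true, b & code u'] else [:: false].

Lemma code_prefix_free {u u' v v'} :
  code u ++ v = code u' ++ v' -> u = u' /\ v = v'.
Proof.
elim: u u' => [|b u IHu] [|b' u'] //= => [[]//|].
by case=> <- /IHu[<- <-].
Qed.

(** The cylinder of [u] consists of the [x] with [agree (size u) (pad u) x]. *)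
Definition cylinder_language : language :=
  [set w | exists u v, w = code u ++ v /\ agree (size u) (pad u) (pad v)].

Lemma left_quotient_code u :
  left_quotient (code u) cylinder_language =
  [set v | agree (size u) (pad u) (pad v)].
Proof.
apply/seteqP; split=> v /=; last by exists u, v.
by case=> u' [v' [/code_prefix_free[<- <-]]].
Qed.

Section embedding.
Context {R : realType}.
Implicit Types f : continuous_cantor R.

Lemma bounded_comp_pad f : bounded_fun (f \o pad).
Proof.
have /Defs.bounded_funP[M fM] := continuous_cantor_bounded f.
by apply/Defs.bounded_funP; exists M => w; exact: fM.
Qed.

Definition restrict_pad f : linfty word R :=
  Linfty (f \o pad) (bounded_comp_pad f).

Lemma restrict_pad_linear : linear restrict_pad.
Proof. by move=> a f g; apply/val_inj. Qed.

HB.instance Definition _ :=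
  GRing.isLinear.Build R (continuous_cantor R) (linfty word R) *:%R
    restrict_pad restrict_pad_linear.

(** The bound from below is the density of the padded words: [f x] differs by
    less than [e] from the value of [f] at a long enough padded prefix of [x]. *)
Lemma restrict_pad_isometry f : `|restrict_pad f| = `|f|.
Proof.
apply/eqP; rewrite eq_le; apply/andP; split.
  apply: linfty_norm_le => // w; rewrite continuous_cantor_normE.
  exact: (le_sup_norm (pad w) (continuous_cantor_bounded f)).
rewrite [leLHS]continuous_cantor_normE; apply: sup_norm_le => // x.
apply/ler_addgt0Pr => e /(iffLR cantor_continuousP (@continuous_cantorP _ f)).
case=> n /(_ _ _ (agree_pad_mkseq n x)) fx.
rewrite -(subrK (f (pad (mkseq x n))) (f x)) (le_trans (ler_normD _ _))//.
by rewrite addrC lerD ?(ltW fx)//; exact: (ler_linfty_norm (restrict_pad f)).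
Qed.

(** A limit [g] of functions [f \o pad] should be [f0 \o pad] with [f0]
    continuous.  As the prefixes of [x], once padded, converge to [x], the value
    of [f0] at [x] is forced to be the limit of [g] along these prefixes.  Any
    [f] with [f \o pad] within [e] of [g] is within [2 e] of [f0], so [f0]
    inherits the uniform continuity of these [f]. *)
Lemma closed_range_restrict_pad : closed (range restrict_pad).
Proof.
move=> g /closureP_norm gP.
have approx e : 0 < e -> exists f : continuous_cantor R,
    forall w, `|g w - f (pad w)| < e.
  move=> /gP[_ [f _ <-] gf]; exists f => w.
  exact: le_lt_trans (ler_linfty_norm (g - restrict_pad f) w) gf.
pose h x n := g (mkseq x n).
have hf (x : cantor_space) e f : 0 < e -> (forall w, `|g w - f (pad w)| < e) ->
    \forall n \near \oo, `|f x - h x n| < e + e.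
  move=> e0 gf.
  have [n nP] := iffLR cantor_continuousP (@continuous_cantorP _ f) _ e0.
  exists n => // m /= nm; rewrite -(subrKA (f (pad (mkseq x m)))).
  rewrite (le_lt_trans (ler_normD _ _))// ltrD//; last by rewrite distrC; exact: gf.
  apply: nP; apply: agree_leq nm _; exact: agree_pad_mkseq.
have cvgh x : cvgn (h x).
  apply/cauchy_cvgP/cauchy_exP => e e0.
  have e20 : 0 < e / 2 by rewrite divr_gt0.
  have [f gf] := approx _ e20; exists (f x).
  by apply: filterS (hf x _ _ e20 gf) => n; rewrite -splitr.
pose f0 (x : cantor_space) : R := limn (h x).
have f0f e f x : 0 < e -> (forall w, `|g w - f (pad w)| < e) ->
    `|f x - f0 x| <= e + e.
  move=> e0 gf.
  have : (fun n => `|f x - h x n|) @ \oo --> `|f x - f0 x|.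
    by apply: cvg_norm; apply: cvgB; [exact: cvg_cst|exact: cvgh].
  by move=> /cvgr_to_le; apply; apply: filterS (hf x e f e0 gf) => n /ltW.
have cf0 : continuous f0.
  apply/cantor_continuousP => e e0.
  (* The path f0 x, f x, f y, f0 y costs 2d + d + 2d = 5d < e for d = e / 6. *)
  have d0 : 0 < e / 6 by rewrite divr_gt0.
  have [f gf] := approx _ d0.
  have [n nP] := iffLR cantor_continuousP (@continuous_cantorP _ f) _ d0.
  exists n => x y /nP fxy.
  have := f0f _ _ x d0 gf; have := f0f _ _ y d0 gf; move: fxy.
  rewrite !(ler_distl, ltr_distl); lra.
exists (ContinuousCantor f0 cf0) => //; apply/val_inj/funext => w /=.
apply/eqP; rewrite -subr_eq0 -normr_le0; apply/ler_addgt0Pr => e e0.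
(* The path f0 (pad w), f (pad w), g w costs 2d + d = e for d = e / 3. *)
have d0 : 0 < e / 3 by rewrite divr_gt0.
have [f gf] := approx _ d0.
have := f0f _ _ (pad w) d0 gf; have := gf w.
rewrite !(ler_distl, ltr_distl); lra.
Qed.

End embedding.

(** The cylinders of the words of length [n] partition the Cantor space, so only
    the term of the prefix of length [n] of [pad w] survives at [w]. *)
Lemma sum_cylinder_indic {R : realType} n (a : n.-tuple bool -> R) w :
  (\sum_u a u *: linfty_indic R
     (left_quotient (code u) cylinder_language)) w
  = a [tuple of mkseq (pad w) n].
Proof.
rewrite (big_morph (fun g : linfty word R => g w) (fun _ _ => erefl) erefl).
have agreeE (u : n.-tuple bool) :
    w \in left_quotient (code u) cylinder_language =
    (u == [tuple of mkseq (pad w) n]).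
  rewrite left_quotient_code; apply/idP/eqP => [/set_mem/= uw|->].
    apply/val_inj/(@eq_from_nth _ false) => [|i]; rewrite size_tuple ?size_mkseq//.
    by move=> ni; rewrite nth_mkseq// -uw// size_tuple.
  by apply/mem_set; rewrite /= size_mkseq; exact/agree_sym/agree_pad_mkseq.
have valE u : (a u *: linfty_indic R (left_quotient (code u) cylinder_language)) w
    = a u * (u == [tuple of mkseq (pad w) n])%:R.
  by rewrite -agreeE -indicE.
rewrite (eq_bigr _ (fun u _ => valE u)) (bigD1 [tuple of mkseq (pad w) n])//=.
by rewrite eqxx mulr1 big1 ?addr0// => u /negbTE ->; rewrite mulr0.
Qed.

(** If [f] varies by less than [e / 2] on each cylinder of length [n], then
    replacing it on the cylinder of [u] by its value at [pad u] gives a step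
    function within [e / 2] of [f]. *)
Lemma range_restrict_pad_residual (R : realType) :
  range restrict_pad `<=` residual_space R cylinder_language.
Proof.
move=> _ [f _ <-]; apply/closureP_norm => e e0.
have e20 : 0 < e / 2 by rewrite divr_gt0.
have [n nP] := iffLR cantor_continuousP (@continuous_cantorP _ f) _ e20.
exists (\sum_(u : n.-tuple bool) f (pad u) *: linfty_indic R
    (left_quotient (code u) cylinder_language)).
  by apply: linear_span_sum => u; exists (code u).
apply: (@le_lt_trans _ _ (e / 2)); last by rewrite ltr_pdivrMr// ltr_pMr// ltr1n.
apply: linfty_norm_le => [|w]; first exact: ltW.
rewrite [X in `|X|](_ : _ = f (pad w) - f (pad [tuple of mkseq (pad w) n])).
  exact/ltW/nP/agree_pad_mkseq.
by rewrite -(sum_cylinder_indic n (fun u => f (pad u)) w).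
Qed.

Theorem theorem9p2 (R : realType) :
  exists L_univ : language,
  exists Y : set (linfty word R),
    [/\ Y `<=` residual_space R L_univ,
        GRing.submod_closed (mem Y),
        closed Y
      & linearly_isometric_to (continuous_cantor R) Y].
Proof.
exists cylinder_language, (range restrict_pad); split.
- exact: range_restrict_pad_residual.
- split=> [|a _ _ /set_mem[f _ <-] /set_mem[g _ <-]]; apply/mem_set.
    by exists 0 => //; exact: linear0.
  by exists (a *: f + g) => //; exact: linearP.
- exact: closed_range_restrict_pad.
- by exists restrict_pad => //; exact: restrict_pad_isometry.
Qed.
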